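(* Let $n\ge 2$ be an integer and let $\mathcal{Y}_{2n+1}$ be the graph obtained from the complete graph $K_{2n+1}$ by adding a new vertex $v_0$ adjacent to exactly three vertices of $K_{2n+1}$. Then $\mathcal{Y}_{2n+1}$ is PMH but not 2FH. Moreover, the vertex $v_0$ is 3-malleable.
   Context: A $2$-factor of a graph is a $2$-regular spanning subgraph (not necessarily connected), a Hamiltonian cycle is a connected $2$-factor, and a perfect matching is the edge set of a $1$-regular spanning subgraph. A Hamiltonian cycle $H$ extends a perfect matching $M$ if $M\subseteq E(H)$. A graph is 2FH (2-factor Hamiltonian) if it has a Hamiltonian cycle and each of its $2$-factors is a Hamiltonian cycle. A graph admitting a perfect matching is PMH if every one of its perfect matchings can be extended to a Hamiltonian cycle. For a vertex $v$, $\partial v$ denotes the set of edges incident to $v$. If $G$ admits a perfect matching and $v$ is a vertex of degree $t\ge 2$, then $v$ is $t$-malleable if for every perfect matching $M$ of $G$ there exist Hamiltonian cycles $H_1,\dots,H_{t-1}$ of $G$, all extending $M$, such that $\partial v - M\subset \bigcup_{i=1}^{t-1}E(H_i)$. *)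

(* Defs.v *)
From mathcomp Require Import all_boot.
Set Implicit Arguments.
Unset Strict Implicit.
Unset Printing Implicit Defensive.

Record sgraph := SGraph {
  vertex :> finType;
  adj : rel vertex;
  adj_sym : symmetric adj;
  adj_irr : irreflexive adj
}.

(* An edge is the two-element set of its endpoints.  A spanning subgraph of G
   is identified with its edge set, a subset of E(G): its vertex set is always
   the whole of G. *)
Definition edges (G : sgraph) : {set {set G}} :=
  [set [set p.1; p.2] | p : G * G & adj p.1 p.2].

Definition incident (G : sgraph) (F : {set {set G}}) (v : G) : {set {set G}} :=
  [set e in F | v \in e].

Definition degree (G : sgraph) (v : G) : nat := #|incident (edges G) v|.

Definition regular_factor (G : sgraph) (k : nat) (F : {set {set G}}) : bool :=
  (F \subset edges G) && [forall v : G, #|incident F v| == k].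

Definition perfect_matching (G : sgraph) (M : {set {set G}}) : bool :=
  regular_factor 1 M.

Definition two_factor (G : sgraph) (F : {set {set G}}) : bool :=
  regular_factor 2 F.

(* The null graph does not count as connected. *)
Definition spanning_connected (G : sgraph) (F : {set {set G}}) : bool :=
  (0 < #|G|) &&
  [forall x : G, forall y : G, connect [rel a b | [set a; b] \in F] x y].

Definition hamiltonian_cycle (G : sgraph) (H : {set {set G}}) : bool :=
  two_factor H && spanning_connected H.

Definition extends (G : sgraph) (H M : {set {set G}}) : bool := M \subset H.

Definition two_factor_hamiltonian (G : sgraph) : Prop :=
  (exists H : {set {set G}}, hamiltonian_cycle H) /\
  (forall F : {set {set G}}, two_factor F -> hamiltonian_cycle F).

Definition has_perfect_matching (G : sgraph) : Prop :=
  exists M : {set {set G}}, perfect_matching M.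

Definition PMH (G : sgraph) : Prop :=
  has_perfect_matching G /\
  (forall M : {set {set G}}, perfect_matching M ->
     exists2 H : {set {set G}}, hamiltonian_cycle H & extends H M).

(* The cycles H_1, ..., H_(t-1) need not be distinct. *)
Definition malleable (G : sgraph) (t : nat) (v : G) : Prop :=
  [/\ has_perfect_matching G, 2 <= t, degree v = t &
      forall M : {set {set G}}, perfect_matching M ->
        exists H : 'I_t.-1 -> {set {set G}},
          (forall i, hamiltonian_cycle (H i) /\ extends (H i) M) /\
          incident (edges G) v :\: M \subset \bigcup_(i < t.-1) H i].

Definition complete_adj (m : nat) : rel 'I_m := fun i j => i != j.

Lemma complete_adj_sym m : symmetric (@complete_adj m).
Proof. by move=> i j; rewrite /complete_adj eq_sym. Qed.

Lemma complete_adj_irr m : irreflexive (@complete_adj m).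
Proof. by move=> i; rewrite /complete_adj eqxx. Qed.

Definition complete_graph (m : nat) : sgraph :=
  SGraph (@complete_adj_sym m) (@complete_adj_irr m).

Definition add_vertex_adj (G : sgraph) (N : {set G}) : rel (option G) :=
  fun x y => match x, y with
  | Some a, Some b => adj a b
  | Some a, None | None, Some a => a \in N
  | None, None => false
  end.

Lemma add_vertex_adj_sym (G : sgraph) (N : {set G}) :
  symmetric (add_vertex_adj N).
Proof. by case=> [a|] [b|] //=; apply: adj_sym. Qed.

Lemma add_vertex_adj_irr (G : sgraph) (N : {set G}) :
  irreflexive (add_vertex_adj N).
Proof. by case=> [a|] //=; apply: adj_irr. Qed.

(* G with one new vertex, None, whose neighbourhood is N. *)
Definition add_vertex (G : sgraph) (N : {set G}) : sgraph :=
  SGraph (add_vertex_adj_sym N) (add_vertex_adj_irr N).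

Definition new_vertex (G : sgraph) (N : {set G}) : add_vertex N := None.

(* Main.v *)
(** If M matches v0 with a, then a Hamiltonian cycle extending M and using v0b,
    for b another neighbour of v0, is obtained by starting with v0, a, listing
    the remaining edges of M in any order, and ending with the edge of M at b:
    all edges missing to close the cycle join vertices of the complete graph,
    except bv0.  The two choices of b give 3-malleability.  A triangle through
    v0 and a cycle through the other 2n - 1 >= 3 vertices form a disconnected
    2-factor. *)
Require Import Defs.
From mathcomp Require Import all_boot.
From mathcomp Require Import zify.
Set Implicit Arguments.
Unset Strict Implicit.
Unset Printing Implicit Defensive.

(** * Cyclic successors in lists, and listing a set by orbits of an involution *)

Lemma set2_inj (T : finType) (x : T) : injective (fun y => [set x; y]).
Proof.
move=> y z /= /setP E.
have := E y; rewrite !inE eqxx orbT => /esym /orP[/eqP yx|/eqP //].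
by have := E z; rewrite !inE eqxx orbT yx orbb => /eqP ->.
Qed.

Lemma next_cat (T : eqType) (s1 s2 : seq T) (x y : T) :
  uniq (s1 ++ x :: y :: s2) -> next (s1 ++ x :: y :: s2) x = y.
Proof.
move=> Us; rewrite -(next_rot (size s1)) // rot_size_cat /= eqxx //.
Qed.

Lemma next_last (T : eqType) (s : seq T) (x y : T) :
  uniq (x :: rcons s y) -> next (x :: rcons s y) y = x.
Proof.
by move=> Us; rewrite -(next_rotr 1 Us) -rcons_cons rotr1_rcons /= eqxx.
Qed.

(** Rotate [s] to start at [x]: two steps lead to the third entry, which differs from [x]. At length
    2 the successor is an involution and traces a single edge. *)
Lemma next_next_neq (T : eqType) (s : seq T) (x : T) :
  uniq s -> 2 < size s -> x \in s -> next s (next s x) != x.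
Proof.
move=> Us s_gt2 /rot_to[i s' Es].
have Us' : uniq (x :: s') by rewrite -Es rot_uniq.
have : 2 < size (x :: s') by rewrite -Es size_rot.
rewrite -!(next_rot i Us) Es.
case: s' {Es} Us' => [|y [|z t]] //= Us' _.
rewrite eqxx; case: ifP Us' => [/eqP->|_]; first by rewrite inE eqxx.
rewrite eqxx; apply: contraTneq => ->.
by rewrite !inE eqxx !orbT.
Qed.

(** Strong induction on the size of [A], removing one orbit at a time. Applied to the mates of a
    perfect matching, it puts the two ends of each matching edge next to each other. *)
Lemma involution_pairs (T : finType) (g : T -> T) (A : {set T}) :
    involutive g -> (forall x, g x != x) -> {in A, forall x, g x \in A} ->
  exists L, let s := flatten [seq [:: x; g x] | x <- L] in uniq s /\ s =i A.
Proof.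
move=> gK g_neq.
elim/ltn_ind: {A}#|A| {-2}A (erefl #|A|) => m IH A cardA gA.
have [->|[x xA]] := set_0Vmem A; first by exists [::]; split=> // x; rewrite inE.
pose B := A :\ x :\ g x.
have ltBA : #|B| < m.
  rewrite -cardA; apply: proper_card; apply/properP; split.
    by apply/subsetP => y; rewrite !inE => /and3P[].
  by exists x; rewrite // !inE eqxx andbF.
have gB : {in B, forall y, g y \in B}.
  move=> y; rewrite !inE => /and3P[ygx yx yA].
  by rewrite (inj_eq (inv_inj gK)) yx (inv_eq gK) ygx gA.
have [L [Us sB]] := IH _ ltBA B erefl gB.
exists (x :: L); split => [|y] /=.
  by rewrite Us inE !sB !inE !eqxx andbF orbF eq_sym g_neq.
rewrite !inE sB !inE.
case: (eqVneq y x) => [->|_] /=; first by rewrite xA.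
by case: (eqVneq y (g x)) => [->|_] //=; rewrite gA.
Qed.

(** * Matchings and 2-factors as edge sets of vertex maps *)

Section Factors.

Variable G : sgraph.
Implicit Types (f g : G -> G) (s : seq G) (M F : {set {set G}}) (x y : G).

Lemma edgesP (e : {set G}) :
  reflect (exists2 p : G * G, adj p.1 p.2 & e = [set p.1; p.2])
          (e \in edges G).
Proof.
by apply: (iffP imsetP) => -[p pE ->]; exists p; move: pE; rewrite ?inE.
Qed.

Lemma edge_at (e : {set G}) x :
  e \in edges G -> x \in e -> exists2 y, adj x y & e = [set x; y].
Proof.
move=> /edgesP[[y z] /= yz ->]; rewrite !inE => /orP[]/eqP->; first by exists z.
by exists y; rewrite 1?adj_sym // setUC.
Qed.

Lemma set2_edges x y : adj x y -> [set x; y] \in edges G.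
Proof. by move=> xy; apply/edgesP; exists (x, y). Qed.

Lemma adj_neq x y : adj x y -> x != y.
Proof. by apply: contraTneq => ->; rewrite adj_irr. Qed.

(** Common encoding of factors: an involution along edges gives a perfect matching, a permutation
    without orbits of length at most 2 gives a 2-factor. *)
Definition fun_edges f : {set {set G}} := [set [set x; f x] | x : G].

Lemma fun_edges_sub f : (forall x, adj x (f x)) -> fun_edges f \subset edges G.
Proof.
by move=> fadj; apply/subsetP => _ /imsetP[x _ ->]; apply: set2_edges.
Qed.

Lemma perfect_matching_involution g :
  involutive g -> (forall x, adj x (g x)) -> perfect_matching (fun_edges g).
Proof.
move=> gK gadj; rewrite /perfect_matching /regular_factor fun_edges_sub //=.
apply/forallP => v; apply/cards1P; exists [set v; g v].
apply/setP => e; rewrite !inE; apply/andP/eqP => [[/imsetP[x _ ->]]|->].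
  by rewrite !inE => /orP[]/eqP-> //; rewrite gK setUC.
by split; [apply: imset_f | rewrite !inE eqxx].
Qed.

(** At [v] one edge leaves for [f v] and one arrives from the preimage of [v]; they differ because
    [f] has no orbit of length 2. *)
Lemma two_factor_injection f :
    injective f -> (forall x, adj x (f x)) -> (forall x, f (f x) != x) ->
  two_factor (fun_edges f).
Proof.
move=> f_inj fadj ff_neq.
rewrite /two_factor /regular_factor fun_edges_sub //=.
apply/forallP => v; apply/cards2P.
pose u := invF f_inj v; have fu : f u = v by apply: f_invF.
exists [set v; f v], [set v; u]; split.
  apply/eqP => /set2_inj fvu.
  by have /eqP := ff_neq u; rewrite fu.
apply/setP => e; rewrite !inE; apply/andP/orP => [[/imsetP[x _ ->]]|].
  rewrite !inE => /orP[]/eqP vx; first by left; rewrite vx.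
  right; have -> : u = x by apply: (f_inj); rewrite fu.
  by rewrite vx setUC.
case=> /eqP->; split; rewrite ?inE ?eqxx //; first exact: imset_f.
by rewrite -{1}fu setUC; apply: imset_f.
Qed.

Lemma hamiltonian_cycle_next s :
    uniq s -> s =i G -> cycle (@adj G) s -> 2 < size s ->
  hamiltonian_cycle (fun_edges (next s)).
Proof.
move=> Us sT adj_s s_gt2; apply/andP; split.
  apply: two_factor_injection => [|x|x].
  - exact: can_inj (prev_next Us).
  - by apply: next_cycle; rewrite ?sT.
  - by apply: next_next_neq; rewrite ?sT.
apply/andP; split.
  by case: s sT s_gt2 {Us adj_s} => // x s _ _; apply/card_gt0P; exists x.
apply/forallP => x; apply/forallP => y.
have : fconnect (next s) x y.
  by rewrite (fconnect_cycle (cycle_next Us)) ?sT.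
apply: connect_sub => {}x _ /eqP <-; apply: connect1.
exact: imset_f.
Qed.

(** Each successor map fixes every vertex outside its own list, so their composite is a permutation
    that runs along both cycles separately. *)
Lemma two_disjoint_cycles s1 s2 :
    uniq (s1 ++ s2) -> s1 ++ s2 =i G ->
    cycle (@adj G) s1 -> cycle (@adj G) s2 -> 2 < size s1 -> 2 < size s2 ->
  exists2 F : {set {set G}}, two_factor F & ~~ spanning_connected F.
Proof.
move=> Us sT adj1 adj2 s1_gt2 s2_gt2.
move: Us; rewrite cat_uniq => /and3P[U1 /hasPn dis U2].
have sT' x : (x \in s2) = (x \notin s1).
  apply/idP/idP => [/dis //|].
  by have := sT x; rewrite mem_cat inE => /orP[->|].
have next_out s x : x \notin s -> next s x = x.
  by move=> xs; rewrite next_nth (negPf xs).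
pose f x := next s1 (next s2 x).
have f1 x : x \in s1 -> f x = next s1 x.
  by move=> x1; rewrite /f (next_out s2) // sT' negbK.
have f2 x : x \in s2 -> f x = next s2 x.
  by move=> x2; rewrite /f next_out // -sT' mem_next.
have f_s1 x : (f x \in s1) = (x \in s1).
  have [x1|x1] := boolP (x \in s1); first by rewrite f1 // mem_next.
  by apply: negbTE; rewrite -sT' f2 ?mem_next sT'.
exists (fun_edges f).
  apply: two_factor_injection => [|x|x].
  - exact: inj_comp (can_inj (prev_next U1)) (can_inj (prev_next U2)).
  - have [x1|] := boolP (x \in s1); first by rewrite f1 // next_cycle.
    by rewrite -sT' => x2; rewrite f2 // next_cycle.
  - have [x1|] := boolP (x \in s1).
      by rewrite !f1 ?mem_next // next_next_neq.
    by rewrite -sT' => x2; rewrite !f2 ?mem_next // next_next_neq.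
apply/negP => /andP[_ /forallP conn].
case: s1 s1_gt2 @f {sT adj1 U1 dis} => // x s1 _ f in sT' f1 f2 f_s1 conn *.
case: s2 s2_gt2 @f {adj2 U2} => // y s2 _ f in sT' f1 f2 f_s1 conn *.
have /forallP/(_ y) := conn x.
(* Since [f] preserves membership in the first list, no edge of the 2-factor leaves it, and [y]
   cannot be reached from [x]. *)
have cl : closed [rel a b | [set a; b] \in fun_edges f] (mem (x :: s1)).
  move=> a b /= /imsetP[z _ ab].
  have : a \in [set z; f z] by rewrite -ab !inE eqxx.
  have : b \in [set z; f z] by rewrite -ab !inE eqxx orbT.
  by rewrite [b \in _]in_set2 [a \in _]in_set2 => /orP[]/eqP-> /orP[]/eqP->;
    rewrite ?f_s1.
move=> /(closed_connect cl); rewrite [x \in _]mem_head => /esym.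
by move: (sT' y); rewrite mem_head => /esym/negP.
Qed.

(** The mate of [x] is the other end of the only edge of [M] at [x]; uniqueness of the edge at [g x]
    makes [g] an involution. *)
Lemma perfect_matching_mate M :
    perfect_matching M ->
  exists g, [/\ involutive g, forall x, adj x (g x) &
                M = fun_edges g].
Proof.
move=> /andP[/subsetP ME /forallP M1].
have /fin_all_exists[g gP] x :
    exists y, adj x y /\ incident M x = [set [set x; y]].
  have /cards1P[e Ie] := M1 x.
  have : e \in incident M x by rewrite Ie set11.
  rewrite inE => /andP[/ME eE xe].
  by have [y xy ee] := edge_at eE xe; exists y; rewrite -ee.
have gM x : [set x; g x] \in M.
  have : [set x; g x] \in incident M x by rewrite (gP x).2 set11.
  by rewrite inE => /andP[].
exists g; split => [x|x|]; last 2 first.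
- by case: (gP x).
- apply/setP => e; apply/idP/imsetP => [eM|[x _ ->] //].
  have [[x y] /= _ ee] := edgesP _ (ME _ eM).
  exists x => //; apply/set1P; rewrite -(gP x).2 inE eM ee !inE eqxx //.
have : [set x; g x] \in incident M (g x) by rewrite inE gM !inE eqxx orbT.
by rewrite (gP (g x)).2 setUC => /set1P /set2_inj.
Qed.

End Factors.

(** * Complete graphs with an added vertex *)

Section AddVertexToComplete.

Variables (m : nat) (N : {set complete_graph m}).
Let Y := add_vertex N.

(** Distinct vertices other than [None] are always adjacent, so any order of them is a path. *)
Lemma sorted_adj_Some (s : seq Y) :
  uniq s -> None \notin s -> sorted (@adj Y) s.
Proof.
move=> Us N_s; apply: pairwise_sorted.
move: Us; rewrite uniq_pairwise; apply: (sub_in_pairwise (P := isSome)).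
  by move=> [a|] [b|].
by apply/allP => -[a|] //; rewrite (negPf N_s).
Qed.

Lemma cycle_adj_Some (s : seq Y) :
  uniq s -> None \notin s -> 1 < size s -> cycle (@adj Y) s.
Proof.
case: s => // x s; case/lastP: s => // s y Us N_s _.
rewrite /cycle rcons_path last_rcons; apply/andP; split.
  exact: sorted_adj_Some Us N_s.
suff : sorted (@adj Y) [:: y; x] by rewrite /= andbT.
apply: sorted_adj_Some.
  by move: Us; rewrite /= !inE mem_rcons inE negb_or eq_sym => /andP[/andP[->]].
by move: N_s; rewrite !inE mem_rcons inE !negb_or => /and3P[-> ->].
Qed.

Lemma adj_new_vertexP (x : Y) :
  reflect (exists2 a, a \in N & x = Some a) (adj (new_vertex N) x).
Proof.
case: x => [a|] /=; last by constructor=> -[].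
by apply: (iffP idP) => [aN|[b bN [->]] //]; exists a.
Qed.

Lemma extend_through (M : {set {set Y}}) (g : Y -> Y) (b : complete_graph m) :
    involutive g -> (forall x, adj x (g x)) -> M = fun_edges g ->
    b \in N -> g None != Some b ->
  exists H : {set {set Y}}, [/\ hamiltonian_cycle H, extends H M &
                               [set None; Some b] \in H].
Proof.
move=> gK gadj -> bN gNb.
have g_neq x : g x != x by rewrite eq_sym adj_neq.
pose v : Y := None; pose w : Y := Some b.
have vw : v != w by [].
have gw_v : g w != v by rewrite (inv_eq gK) eq_sym.
(* The vertices off the matching edges at the new vertex and at [b]; these two edges are distinct
   since [g None] is not [b]. *)
pose A : {set Y} := ~: [set v; g v; w; g w].
have gA : {in A, forall x, g x \in A}.
  move=> x; rewrite !inE !(inj_eq (inv_inj gK)).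
  rewrite (inv_eq gK x) (inv_eq gK x w).
  by do 4!case: (x == _).
have [L [Us sA]] := involution_pairs gK g_neq gA.
(* One end of each matching edge. The last one is [g w], so that the flattened list ends in [w] and
   the closing edge is the required [wv]. *)
pose L' := v :: rcons L (g w).
pose s := flatten [seq [:: x; g x] | x <- L'].
have Es : s = v :: g v :: flatten [seq [:: x; g x] | x <- L] ++ [:: g w; w].
  by rewrite /s /= map_rcons flatten_rcons gK.
have {}Us : uniq s.
  rewrite Es /= cat_uniq Us /= !inE !mem_cat !inE !sA !inE !eqxx /= !orbT /=.
  rewrite (inj_eq (inv_inj gK)) [v == g v]eq_sym [v == g w]eq_sym.
  by rewrite (negPf (g_neq v)) (negPf gw_v) (negPf gNb) (negPf vw) g_neq.
have sT : s =i Y.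
  move=> x; rewrite Es !inE mem_cat sA !inE.
  by do 4!case: (x == _).
have adj_s : cycle (@adj Y) s.
  move: Us; rewrite Es (cycle_path v) /=.
  (* The closing edge comes from [bN] and the first edge from the matching; the rest of the path
     avoids [None]. *)
  rewrite last_cat /= bN => /= /andP[Nv Us].
  apply/andP; split; first exact: (gadj v).
  exact: (@sorted_adj_Some (g v :: _ ++ _) Us Nv).
have s_gt2 : 2 < size s by rewrite Es /= size_cat addn2.
exists (fun_edges (next s)); split; first exact: hamiltonian_cycle_next.
  apply/subsetP => _ /imsetP[x _ ->].
  (* The edge of [M] at [x] is that of a listed representative [y], whose successor in [s] is its
     mate. *)
  have /flatten_mapP[y yL'] : x \in s by rewrite sT.
  move=> xy; have -> : [set x; g x] = [set y; g y].
    by move: xy; rewrite !inE => /orP[]/eqP-> //; rewrite gK setUC.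
  have [L1 [L2 EL]] : exists L1 L2, L' = L1 ++ y :: L2.
    by case/splitPr: yL' => L1 L2; exists L1, L2.
  have -> : g y = next s y; last exact: imset_f.
  have Es' : s = flatten [seq [:: x; g x] | x <- L1] ++ y :: g y ::
                 flatten [seq [:: x; g x] | x <- L2].
    by rewrite /s EL map_cat flatten_cat.
  by rewrite Es' next_cat -?Es'.
have nw : next s w = v.
  have Es' : s = v :: rcons (g v :: rcons (flatten [seq [:: x; g x] | x <- L])
                                          (g w)) w.
    by rewrite Es -cat_rcons cats1.
  by rewrite Es' next_last -?Es'.
by rewrite setUC -[None]nw; apply: imset_f.
Qed.

(** Match the new vertex with some [a] in [N], and pair the other m - 1 vertices by reversing their
    order. *)
Lemma add_vertex_has_perfect_matching :
  odd m -> N != set0 -> has_perfect_matching (add_vertex N).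
Proof.
move=> m_odd /set0Pn[a aN].
pose g (x : Y) : Y := match x with
  | None => Some a
  | Some i => if unlift a i is Some j then Some (lift a (rev_ord j)) else None
  end.
have gK : involutive g.
  case=> [i|] /=; last by rewrite unlift_none.
  case: unliftP => [j ->|-> //] /=.
  by rewrite liftK rev_ordK.
exists (fun_edges g); apply: perfect_matching_involution => // -[i|] //=.
case: unliftP => [j ->|-> //] /=.
(* A fixed point of the reversal would give 2j + 1 = m - 1, impossible for odd m. *)
rewrite /complete_adj (inj_eq (@lift_inj _ a)) -val_eqE /=.
by have := ltn_ord j; lia.
Qed.

Lemma degree_new_vertex : degree (new_vertex N) = #|N|.
Proof.
have inj : injective (fun a : complete_graph m => [set (None : Y); Some a]).
  by move=> a b /set2_inj [].
rewrite -(card_imset _ inj); apply: eq_card => e; rewrite inE.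
apply/andP/imsetP => [[eE Ne]|[a aN ->]].
  by have [x /adj_new_vertexP[a aN ->] ->] := edge_at eE Ne; exists a.
by rewrite !inE eqxx; split => //; apply: set2_edges.
Qed.

Lemma add_vertex_malleable :
  odd m -> #|N| = 3 -> malleable 3 (new_vertex N).
Proof.
move=> m_odd N3; split => //; last 2 first.
- by rewrite degree_new_vertex.
- move=> M /perfect_matching_mate[g [gK gadj EM]].
  have /adj_new_vertexP[a aN ga] := gadj None.
  (* The two edges at the new vertex outside [M] lead to [b] and [c]; each gets its own cycle. *)
  have /eqP/cards2P[b [c [_ Nbc]]] : #|N :\ a| = 2.
    by apply/eqP; rewrite -eqSS -N3 (cardsD1 a N) aN.
  have other y : y \in N :\ a -> (y \in N) /\ g None != Some y.
    rewrite !inE => /andP[ya yN]; split => //; rewrite ga.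
    by apply: contraNneq ya => -[->].
  have [bN gb] : (b \in N) /\ g None != Some b.
    by apply: other; rewrite Nbc !inE eqxx.
  have [cN gc] : (c \in N) /\ g None != Some c.
    by apply: other; rewrite Nbc !inE eqxx orbT.
  have [Hb [hamb extb Hb_b]] := extend_through gK gadj EM bN gb.
  have [Hc [hamc extc Hc_c]] := extend_through gK gadj EM cN gc.
  exists (fun i => if i == ord0 then Hb else Hc); split => [i|].
    by case: ifP.
  apply/subsetP => e; rewrite !inE => /andP[eM /andP[eE Ne]].
  have [x /adj_new_vertexP[y yN ->] ee] := edge_at eE Ne.
  have : y \in N :\ a.
    rewrite !inE yN andbT; apply: contraNneq eM => ya.
    by rewrite EM ee ya -ga; apply: imset_f.
  rewrite Nbc !inE => /orP[]/eqP yy; apply/bigcupP.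
    by exists ord0; rewrite // ee yy.
  by exists ord_max; rewrite // ee yy.
by apply: add_vertex_has_perfect_matching => //; rewrite -card_gt0 N3.
Qed.

Lemma malleable_PMH (G : sgraph) (t : nat) (v : G) : malleable t v -> PMH G.
Proof.
case=> hpm t_gt1 _ malM; split => // M /malM[H [HP _]].
have t1_gt0 : 0 < t.-1 by case: t t_gt1 {malM H HP} => [|[]].
by have [? ?] := HP (Ordinal t1_gt0); exists (H (Ordinal t1_gt0)).
Qed.

Lemma add_vertex_not_2FH :
  4 < m -> 1 < #|N| -> ~ two_factor_hamiltonian (add_vertex N).
Proof.
move=> m_gt4 /card_gt1P[a [b [aN bN ab]]] [_ ham].
pose s1 : seq Y := [:: None; Some a; Some b].
pose s2 : seq Y := enum [predC s1].
have U1 : uniq s1 by rewrite /= !inE (inj_eq Some_inj) ab.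
have N_s2 : None \notin s2 by rewrite mem_enum.
(* The triangle leaves m - 2 of the m + 1 vertices, at least 3 because m > 4, hence enough for a
   cycle. *)
have sz2 : size s2 = m.-2.
  have : 3 + size s2 = m.+1.
    by rewrite -cardE -[3]/(size s1) -(card_uniqP U1) cardC card_option card_ord.
  by lia.
have U2 : uniq s2 by rewrite enum_uniq.
have [F F2 Fcon] : exists2 F : {set {set Y}},
    two_factor F & ~~ spanning_connected F.
  apply: (two_disjoint_cycles (s1 := s1) (s2 := s2)) => //.
  - rewrite cat_uniq U1 U2 andbT /=; apply/hasPn => x.
    by rewrite mem_enum inE.
  - by move=> x; rewrite mem_cat mem_enum !inE orbN.
  - by rewrite /= aN bN /complete_adj ab.
  - by apply: cycle_adj_Some; rewrite // sz2; lia.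
  - by rewrite sz2; lia.
by have /andP[_] := ham F F2; apply/negP.
Qed.

End AddVertexToComplete.

Theorem proposition2p6 (n : nat) (hn : 2 <= n)
  (N : {set complete_graph (2 * n + 1)}) (hN : #|N| = 3) :
  [/\ PMH (add_vertex N),
      ~ two_factor_hamiltonian (add_vertex N)
    & malleable 3 (new_vertex N)].
Proof.
have m_odd : odd (2 * n + 1) by rewrite addn1 mul2n /= odd_double.
have mal := add_vertex_malleable m_odd hN.
split=> //; first exact: malleable_PMH mal.
by apply: add_vertex_not_2FH; rewrite ?hN //; lia.
Qed.
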